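(* Let $\{\mathcal{S}(t)\}_{t\ge0}$ be a GSP with parameters $\lambda_1,\dots,\lambda_k,\mu_1,\dots,\mu_k\ge0$, $\Lambda=\sum_j\lambda_j$, $T=\sum_j\mu_j$, $\Lambda+T>0$, and let $\mathcal{S}_A(t)=\frac1t\int_0^t\mathcal{S}(s)\,ds$. Let $\{N(t)\}_{t\ge0}$ be a Poisson process with rate $\Lambda+T$, and $X_1,X_2,\dots$ i.i.d., independent of $N$, with density $$f(x)=\frac{1}{\Lambda+T}\sum_{j=1}^k\frac{\lambda_j}{j}\mathbf{1}_{[0,j]}(x)+\frac{1}{\Lambda+T}\sum_{j=1}^k\frac{\mu_j}{j}\mathbf{1}_{[-j,0]}(x).$$ Then for every $t>0$, $\mathcal{S}_A(t)\overset{d}{=}\sum_{i=1}^{N(t)}X_i$.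
   Context: A generalized counting process (GCP) with rates $\lambda_1,\dots,\lambda_k\ge0$ is a Lévy process $\{\mathbb{M}(t)\}_{t\ge0}$ with $\mathbb{M}(0)=0$ and $\mathbb{E}[u^{\mathbb{M}(t)}]=\exp\left(t\sum_{j=1}^k\lambda_j(u^j-1)\right)$. A generalized Skellam process (GSP) is $\mathcal{S}(t)=\mathbb{M}_1(t)-\mathbb{M}_2(t)$ where $\mathbb{M}_1,\mathbb{M}_2$ are independent GCPs with rates $\lambda_1,\dots,\lambda_k$ and $\mu_1,\dots,\mu_k$ respectively. *)

(* Defs.v *)
From HB Require Import structures.
From mathcomp Require Import all_boot all_order all_algebra.
From mathcomp Require Import all_classical all_reals all_analysis.
Set Implicit Arguments. Unset Strict Implicit. Unset Printing Implicit Defensive.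
Import Order.TTheory GRing.Theory Num.Theory.
Import numFieldNormedType.Exports.
Local Open Scope classical_set_scope.
Local Open Scope ring_scope.

Section Defs.
Context {R : realType} {d : measure_display} {Omega : measurableType d}.
Variable P : probability Omega R.

Definition sigma_of (X : Omega -> R) : set (set Omega) :=
  preimage_set_system setT X measurable.

Definition sigma_fam {I : Type} (D : set I) (X : I -> Omega -> R)
  : set (set Omega) :=
  <<s setT, \bigcup_(i in D) sigma_of (X i) >>.

Definition indep_family {I : eqType} (F : I -> set (set Omega)) : Prop :=
  forall (s : seq I) (A : I -> set Omega), uniq s ->
    (forall i, i \in s -> F i (A i)) ->
    P (\big[setI/setT]_(i <- s) A i) = (\prod_(i <- s) P (A i))%E.

Definition indep2 (F G : set (set Omega)) : Prop :=
  forall A B, F A -> G B -> P (A `&` B) = (P A * P B)%E.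

Definition indep_increments (Y : R -> Omega -> R) : Prop :=
  forall (n : nat) (t : nat -> R),
    0 <= t 0%N -> (forall i, (i < n)%N -> t i <= t i.+1) ->
    indep_family (fun i : 'I_n =>
      sigma_of (fun w => Y (t i.+1) w - Y (t i) w)).

End Defs.

Section Defs2.
Context {R : realType}.

Definition eq_in_law {d1 d2 : measure_display}
  {O1 : measurableType d1} {O2 : measurableType d2}
  (P1 : probability O1 R) (P2 : probability O2 R)
  (X1 : O1 -> R) (X2 : O2 -> R) : Prop :=
  forall B : set R, measurable B -> P1 (X1 @^-1` B) = P2 (X2 @^-1` B).

Definition cadlag (f : R -> R) : Prop :=
  (forall t, 0 <= t -> f @ at_right t --> f t) /\
  (forall t, 0 < t -> cvg (f @ at_left t)).

Definition levy_nat {d : measure_display} {Omega : measurableType d}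
  (P : probability Omega R) (M : R -> Omega -> nat) : Prop :=
  let Y := fun t w => (M t w)%:R : R in
  [/\ (forall t, 0 <= t -> measurable_fun setT (Y t)),
      (forall w, M 0 w = 0%N),
      (forall w, cadlag (fun t => Y t w)),
      indep_increments P Y &
      (forall s t, 0 <= s -> 0 <= t ->
        eq_in_law P P (fun w => Y (t + s) w - Y s w)
                      (fun w => Y t w - Y 0 w))].

(* generalized counting process with rates lam 1, ..., lam k
   (jump of size j has rate lam j) *)
Definition GCP {d : measure_display} {Omega : measurableType d}
  (P : probability Omega R) (k : nat) (lam : nat -> R)
  (M : R -> Omega -> nat) : Prop :=
  levy_nat P M /\
  forall t u, 0 <= t -> 0 <= u <= 1 ->
    (\int[P]_w (u ^+ M t w)%:E)%E =
    (expR (t * \sum_(1 <= j < k.+1) lam j * (u ^+ j - 1)))%:E.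

Definition poisson_process {d : measure_display} {Omega : measurableType d}
  (P : probability Omega R) (nu : R) (N : R -> Omega -> nat) : Prop :=
  [/\ (forall t, 0 <= t -> measurable_fun setT (fun w => (N t w)%:R : R)),
      (forall w, N 0 w = 0%N),
      (forall w s t, 0 <= s <= t -> (N s w <= N t w)%N),
      indep_increments P (fun t w => (N t w)%:R) &
      (forall s t (n : nat), 0 <= s <= t ->
        P [set w | (N t w - N s w)%N = n] =
        (expR (- (nu * (t - s))) * (nu * (t - s)) ^+ n / (n`!)%:R)%:E)].

Definition gsp_density (k : nat) (lam mu : nat -> R) (x : R) : R :=
  let Lam := \sum_(1 <= j < k.+1) lam j in
  let Tm := \sum_(1 <= j < k.+1) mu j in
  (Lam + Tm)^-1 * (\sum_(1 <= j < k.+1) lam j / j%:R *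
                      (if (0 <= x <= j%:R) then 1 else 0))
  + (Lam + Tm)^-1 * (\sum_(1 <= j < k.+1) mu j / j%:R *
                      (if (- j%:R <= x <= 0) then 1 else 0)).

Definition has_density {d : measure_display} {Omega : measurableType d}
  (P : probability Omega R) (X : Omega -> R) (f : R -> R) : Prop :=
  measurable_fun setT X /\
  forall B : set R, measurable B ->
    P (X @^-1` B) = (\int[lebesgue_measure]_(x in B) (f x)%:E)%E.

Definition time_avg {Omega : Type} (M1 M2 : R -> Omega -> nat) (t : R)
  (w : Omega) : R :=
  let D := `[0, t]%classic in
  t^-1 * fine (\int[lebesgue_measure]_(s in D)
                 ((M1 s w)%:R - (M2 s w)%:R : R)%:E)%E.

End Defs2.

(* Main.v *)
Require Import Defs.
From HB Require Import structures.
From mathcomp Require Import all_boot all_order all_algebra.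
From mathcomp Require Import all_classical all_reals all_analysis.
From mathcomp Require Import measurable_realfun ring lra.
Import Order.TTheory GRing.Theory Num.Theory.
Import numFieldNormedType.Exports.
Local Open Scope classical_set_scope.
Local Open Scope ring_scope.

(** Let A1, A2 be the time averages of M1, M2, and let B+, B- be the sums over
    i < N(t) of the positive and negative parts of the X_i.  Riemann sums of the
    (cadlag) paths and the independent stationary increments give the Laplace
    transforms of A1 and A2; conditioning on N(t) gives the joint Laplace
    transform of (B+, B-), which turns out to be their product.  A weighted form
    of the uniqueness of Laplace transforms on the half-line, applied to one
    coordinate at a time, shows that (A1, A2) and (B+, B-) have the same law,
    and the theorem follows from S_A(t) = A1 - A2 and sum X_i = B+ - B-. *)

(** * Integrals against a law, and independence *)

(** The match rests on one fact: a jump of size [j] at a uniform time of [[0, t]] adds to the time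
    average [j] times a uniform fraction of [[0, 1]], and the uniform laws on [[0, j]] and [[-j, 0]]
    are the components of the density. It enters through [unif_laplace], at once a limit of Riemann
    sums (processes) and an integral against the density (jumps), so no closed form is computed. The
    joint transform of the sums factors because each component lies on one side of 0: the exponent
    is a function of [a] plus a function of [b], as in the thinning of a Poisson process. Positive
    and negative parts are separated because uniqueness is proved with powers of [exp(-A)], which
    lie in [[0, 1]] only for [A >= 0]; natural arguments of the transform then suffice. The weight
    replaces a two-variable uniqueness theorem: it carries first the transform of the other
    coordinate, then the indicator of an event of that coordinate. *)

Lemma integral_EFin_indic {R : realType} {d : measure_display}
    {T : measurableType d} (m : {measure set T -> \bar R}) (W : T -> R)
    (A : set T) :
  (\int[m]_(x in A) (W x)%:E = \int[m]_x (W x * \1_A x)%:E)%E.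
Proof.
rewrite integral_mkcond; apply: eq_integral => x _.
rewrite patchE indicE; case: ifPn => _; first by rewrite mulr1.
by rewrite mulr0.
Qed.

Lemma measurable_preimage {d1 d2 : measure_display} {T1 : measurableType d1}
    {T2 : measurableType d2} (f : T1 -> T2) (B : set T2) :
  measurable_fun setT f -> measurable B -> measurable (f @^-1` B).
Proof. by move=> mf mB; rewrite -[X in measurable X]setTI; exact: mf. Qed.

Section eq_weighted_integral.
Import HBNNSimple.

(** The images under [D1], [D2] of the measures with densities [W1], [W2] agree on Borel sets, hence
    on simple functions, hence on [g] by monotone convergence. A constant weight expresses
    independence; Lebesgue measure weighted by a density gives the transfer formula for a law. *)
Lemma eq_weighted_integral {R : realType} {d1 d2 : measure_display}
    {T1 : measurableType d1} {T2 : measurableType d2}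
    (m1 : {measure set T1 -> \bar R}) (m2 : {measure set T2 -> \bar R})
    (W1 : T1 -> R) (W2 : T2 -> R) (D1 : T1 -> R) (D2 : T2 -> R)
    (g : R -> R) :
  (forall x, 0 <= W1 x) -> (forall x, 0 <= W2 x) ->
  measurable_fun setT W1 -> measurable_fun setT W2 ->
  measurable_fun setT D1 -> measurable_fun setT D2 ->
  (forall B, measurable B ->
    \int[m1]_(x in D1 @^-1` B) (W1 x)%:E =
    \int[m2]_(x in D2 @^-1` B) (W2 x)%:E)%E ->
  (forall x, 0 <= g x) -> measurable_fun setT g ->
  (\int[m1]_x (W1 x * g (D1 x))%:E = \int[m2]_x (W2 x * g (D2 x))%:E)%E.
Proof.
move=> W10 W20 mW1 mW2 mD1 mD2 eqW g0 mg.
have mEg : measurable_fun setT (EFin \o g) by exact/measurable_EFinP.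
pose h := nnsfun_approx measurableT mEg.
have aux d (T : measurableType d) (m : {measure set T -> \bar R}) (W : T -> R)
    (D : T -> R) : (forall x, 0 <= W x) -> measurable_fun setT W ->
    measurable_fun setT D ->
    ((\int[m]_x (W x * h n (D x))%:E)%E @[n --> \oo] -->
      (\int[m]_x (W x * g (D x))%:E)%E) /\
    forall n, (\int[m]_x (W x * h n (D x))%:E =
      \sum_(y \in range (h n)) y%:E * \int[m]_(x in D @^-1` (h n @^-1` [set y])) (W x)%:E)%E.
  move=> W0 mW mD; split.
    have cv x : (W x * h n (D x))%:E @[n --> \oo] --> (W x * g (D x))%:E.
      have hg : (h n (D x))%:E @[n --> \oo] --> (g (D x))%:E.
        exact: (cvg_nnsfun_approx measurableT mEg (fun x _ => g0 x)).
      by rewrite EFinM; under eq_fun do rewrite EFinM; exact: cvgeZl.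
    under eq_integral => x _.
      rewrite -(cvg_lim _ (cv x))//; over.
    apply: cvg_monotone_convergence => //.
    - move=> n; apply/measurable_EFinP; apply: measurable_funM => //.
      exact: measurableT_comp.
    - by move=> n x _; rewrite lee_fin mulr_ge0.
    - move=> x _ a b ab; rewrite lee_fin ler_wpM2l//.
      exact/lefP/(nd_nnsfun_approx measurableT mEg).
  move=> n.
  under eq_integral => x _.
    rewrite fimfunE EFinM -fsumEFin// ge0_mule_fsumr; last first.
      by move=> y; exact: nnfun_muleindic_ge0.
    over.
  rewrite ge0_integral_fsum//.
  - apply: eq_fsbigr => y /[!inE] -[z _ <-].
    rewrite integral_EFin_indic -ge0_integralZl//; last 3 first.
    + apply/measurable_EFinP; apply: measurable_funM => //.
      by apply: measurable_indic; exact: measurable_preimage.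
    + by move=> x _; rewrite lee_fin mulr_ge0.
    + by rewrite lee_fin.
    by apply: eq_integral => x _; rewrite -!EFinM mulrCA.
  - move=> y; apply/measurable_EFinP; apply: measurable_funM => //.
    apply: measurable_funM => //.
    have mh : measurable_fun [set: R] (\1_(h n @^-1` [set y]) : R -> R) by exact: measurable_indic.
    exact: (measurableT_comp mh).
  - by move=> y x _; apply: mule_ge0; [rewrite lee_fin|exact: nnfun_muleindic_ge0].
have [c1 e1] := aux _ _ m1 _ _ W10 mW1 mD1.
have [c2 e2] := aux _ _ m2 _ _ W20 mW2 mD2.
apply: (cvg_unique _ c1) => //.
suff -> : (fun n => \int[m1]_x (W1 x * h n (D1 x))%:E)%E =
  (fun n => \int[m2]_x (W2 x * h n (D2 x))%:E)%E by [].
(* Both sums run over the range of the same simple function [h n], so they agree term by term. *)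
apply/funext => n; rewrite e1 e2.
by apply: eq_fsbigr => y _; rewrite eqW.
Qed.

End eq_weighted_integral.

Lemma indep_integral_prod {R : realType} {d : measure_display}
    {Omega : measurableType d} (P : probability Omega R) {I : eqType}
    (Y : I -> Omega -> R) (g : I -> R -> R) (p : I -> R) (s : seq I) :
  (forall i, measurable_fun setT (Y i)) ->
  (forall i x, 0 <= g i x) -> (forall i, measurable_fun setT (g i)) ->
  (forall i, \int[P]_w (g i (Y i w))%:E = (p i)%:E)%E ->
  indep_family P (fun i => sigma_of (Y i)) -> uniq s ->
  (\int[P]_w (\prod_(i <- s) g i (Y i w))%:E = (\prod_(i <- s) p i)%:E)%E.
Proof.
move=> mY g0 mg gp indY us.
have p0 i : 0 <= p i.
  by rewrite -lee_fin -gp; apply: integral_ge0 => w _; rewrite lee_fin.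
have mC (s2 : seq I) (A : I -> set R) : (forall i, measurable (A i)) ->
    measurable (\big[setI/setT]_(i <- s2) (Y i @^-1` A i)).
  by move=> mA; apply: bigsetI_measurable => i _; exact: measurable_preimage.
have mW (s1 : seq I) : measurable_fun setT (fun w => \prod_(i <- s1) g i (Y i w)).
  by apply: measurable_prod => i _; exact: measurableT_comp.
(* The indicators are replaced by the functions [g i] one index at a time. *)
suff H (s1 s2 : seq I) (A : I -> set R) : uniq (s1 ++ s2) ->
    (forall i, measurable (A i)) ->
    (\int[P]_(w in \big[setI/setT]_(i <- s2) (Y i @^-1` A i))
       (\prod_(i <- s1) g i (Y i w))%:E =
     (\prod_(i <- s1) p i * \prod_(i <- s2) fine (P (Y i @^-1` A i)))%:E)%E.
  have := H s [::] (fun=> setT); rewrite cats0 => /(_ us (fun=> measurableT)).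
  by rewrite !big_nil mulr1.
elim: s1 s2 A => [|i s1 IH] s2 A us2 mA.
  under eq_integral do rewrite big_nil.
  rewrite integral_cst//; last exact: mC.
  rewrite mul1e big_nil mul1r.
  transitivity (\prod_(i <- s2) P (Y i @^-1` A i))%E.
    by apply: indY => // i _; exists (A i) => //; rewrite setTI.
  rewrite -prodEFin; apply: eq_bigr => i _; rewrite fineK// fin_num_measure//.
  exact: measurable_preimage.
move: us2 => /= /andP[]; rewrite mem_cat negb_or => /andP[is1 is2] us2.
set S := \big[setI/setT]_(i <- s2) _.
pose c := \prod_(i <- s1) p i * \prod_(i <- s2) fine (P (Y i @^-1` A i)).
have c0 : 0 <= c.
  by rewrite mulr_ge0 ?prodr_ge0// => j _; rewrite fine_ge0.
rewrite integral_EFin_indic.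
under eq_integral do rewrite big_cons -mulrA mulrC.
transitivity (\int[P]_w (c * g i (Y i w))%:E)%E; last first.
  under eq_integral do rewrite EFinM.
  rewrite ge0_integralZl//; last 2 first.
  - by apply/measurable_EFinP; exact: measurableT_comp.
  - by move=> w _; rewrite lee_fin.
  rewrite gp big_cons -EFinM /c.
  by congr EFin; rewrite mulrC mulrA.
apply: (@eq_weighted_integral R _ _ _ _ P P
  (fun w => \prod_(j <- s1) g j (Y j w) * \1_S w) (fun=> c) (Y i) (Y i) (g i)) => //.
- by move=> w; rewrite mulr_ge0// prodr_ge0.
- by apply: measurable_funM => //; apply: measurable_indic; exact: mC.
move=> B mB; rewrite integral_cst//; last exact: measurable_preimage.
(* Since [i] is not in [s2], changing the set at [i] leaves the old events alone. *)
pose A' j := if j == i then B else A j.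
have eqA' (T : Type) (F : set R -> I -> T) (op : T -> T -> T) (idx : T) :
    \big[op/idx]_(j <- s2) F (A' j) j = \big[op/idx]_(j <- s2) F (A j) j.
  apply: eq_big_seq => j js2; rewrite /A'; case: eqP => // ji.
  by move: is2; rewrite -ji js2.
have := IH (i :: s2) A' _ _.
rewrite !big_cons /A' eqxx -/A' (eqA' _ (fun A i => Y i @^-1` A)).
rewrite (eqA' _ (fun A i => fine (P (Y i @^-1` A)))) -/S => IH'.
rewrite -[X in (_ * X)%E]fineK ?fin_num_measure//; last exact: measurable_preimage.
rewrite -EFinM /c mulrAC -mulrA -IH'; first last.
- by move=> j; case: ifP.
- by rewrite -[_ ++ _]/(s1 ++ [:: i] ++ s2) uniq_catCA /= mem_cat negb_or is1 is2.
rewrite [LHS]integral_EFin_indic [RHS]integral_EFin_indic.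
by apply: eq_integral => w _; rewrite indicI /=; congr EFin; rewrite mulrAC mulrA.
Qed.

(** * Uniqueness of Laplace transforms *)

Lemma bernoulli_sub_le {R : realFieldType} (y : R) (K : nat) :
  0 <= y <= 1 -> 1 - K%:R * y <= (1 - y) ^+ K.
Proof.
move=> /andP[y0 y1]; elim: K => [|K IH]; first by rewrite mul0r subr0 expr0.
rewrite exprS -nat1r.
have : (1 - y) * (1 - K%:R * y) <= (1 - y) * (1 - y) ^+ K.
  by rewrite ler_wpM2l// subr_ge0.
apply: le_trans.
have : 0 <= K%:R * y ^+ 2 by rewrite mulr_ge0// exprn_ge0.
by rewrite expr2; nra.
Qed.

(** A division-free upper bound of the power by [1 / (1 + K y)], which forces it to 0 when [K y] is
    large; Bernoulli's inequality keeps it near 1 when [K y] is small. *)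
Lemma expr_onem_mul_le1 {R : realFieldType} (y : R) (K : nat) :
  0 <= y <= 1 -> (1 - y) ^+ K * (1 + K%:R * y) <= 1.
Proof.
move=> /andP[y0 y1]; elim: K => [|K IH]; first by rewrite mul0r addr0 expr0 mulr1.
apply: le_trans IH; rewrite exprSr -mulrA ler_wpM2l//.
  by rewrite exprn_ge0// subr_ge0.
rewrite -nat1r.
have : 0 <= K%:R * y ^+ 2 by rewrite mulr_ge0// exprn_ge0.
by rewrite expr2; nra.
Qed.

(* With [K := cutoff_exp c n], the product [K * x ^+ n.+1] tends to 0 if [x <= c]
   and to infinity if [c < x], so that [(1 - x ^+ n.+1) ^+ K] tends to the
   indicator of [x <= c], the value at [x = c] included. *)
Definition cutoff_exp {R : realType} (c : R) (n : nat) : nat :=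
  Num.truncn (c^-1 ^+ n.+1 / n.+1%:R).

(** With [q] the square root of [r], one of the two factors [q ^+ n.+1] absorbs the numerator up to
    the constant [(q - 1)^-1], and the other leaves a geometric sequence. *)
Lemma cvg_natr_div_exp {R : realType} (r : R) : 1 < r ->
  n.+1%:R / r ^+ n.+1 @[n --> \oo] --> (0 : R).
Proof.
move=> r1; have r0 : 0 < r by exact: lt_trans r1.
pose q := Num.sqrt r.
have q1 : 1 < q by rewrite -[1](@sqrtr1 R) ltr_sqrt.
have q0 : 0 < q by exact: lt_trans q1.
have rq : r = q ^+ 2 by rewrite sqr_sqrtr// ltW.
have le n : n%:R * (q - 1) <= q ^+ n.
  elim: n => [|n IH]; first by rewrite mul0r.
  rewrite exprS -nat1r.
  have qn : 1 <= q ^+ n by rewrite exprn_ege1// ltW.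
  nra.
apply: (@squeeze_cvgr _ _ _ _ (cst 0) (geometric ((q - 1)^-1 * q^-1) q^-1)).
- apply: nearW => n /=; have rn : 0 <= r ^+ n.+1 by rewrite exprn_ge0// ltW.
  rewrite divr_ge0//=.
  have -> : (q - 1)^-1 * q^-1 * q^-1 ^+ n = (q - 1)^-1 / q ^+ n.+1.
    by rewrite -mulrA -exprS exprVn.
  rewrite rq exprAC expr2 invfM mulrA.
  rewrite ler_wpM2r//; first by rewrite invr_ge0 exprn_ge0// ltW.
  by rewrite ler_pdivrMr ?exprn_gt0// ler_pdivlMl ?subr_gt0// mulrC le.
- exact: cvg_cst.
- apply: cvg_geometric; rewrite ger0_norm ?invr_ge0 ?ltW//.
  by rewrite invf_lt1.
Qed.

Lemma cvg_cutoff {R : realType} (c x : R) : 0 < c < 1 -> 0 <= x <= 1 ->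
  (1 - x ^+ n.+1) ^+ cutoff_exp c n @[n --> \oo] --> ((x <= c)%R%:R : R).
Proof.
move=> /andP[c0 c1] /andP[x0 x1].
have y01 n : 0 <= x ^+ n.+1 <= 1 by rewrite exprn_ge0//= exprn_ile1.
have y1 n : 0 <= 1 - x ^+ n.+1 <= 1.
  by have /andP[h0 h1] := y01 n; rewrite subr_ge0 h1/= lerBlDr lerDl.
have arg0 n : 0 <= c^-1 ^+ n.+1 / n.+1%:R :> R.
  by rewrite divr_ge0// exprn_ge0// invr_ge0 ltW.
have [xc|cx] := leP x c.
  apply: (@squeeze_cvgr _ _ _ _ (fun n => 1 - harmonic n) (cst 1)).
  - apply: nearW => n /=; have /andP[h0 h1] := y1 n.
    rewrite exprn_ile1// andbT (le_trans _ (bernoulli_sub_le _ _ (y01 n)))//.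
    rewrite lerD2l lerN2.
    have /andP[K1 _] := truncn_itv (arg0 n).
    (* At [x = c] the powers cancel exactly; the divisor [n.+1] in [cutoff_exp] still drives the
       bound to 0. *)
    apply: (@le_trans _ _ ((c^-1 ^+ n.+1 / n.+1%:R) * c ^+ n.+1)).
      by rewrite ler_pM// ?exprn_ge0// lerXn2r// ?nnegrE// ltW.
    by rewrite mulrAC -exprMn mulVf ?gt_eqF// expr1n mul1r.
  - rewrite -[X in _ --> X]subr0; apply: cvgB; first exact: cvg_cst.
    exact: cvg_harmonic.
  - exact: cvg_cst.
have r1 : 1 < x / c by rewrite ltr_pdivlMr// mul1r.
apply: (@squeeze_cvgr _ _ _ _ (cst 0) (fun n => n.+1%:R / (x / c) ^+ n.+1)).
- apply: nearW => n /=; have /andP[h0 h1] := y1 n.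
  rewrite exprn_ge0//=.
  have K2 := truncnS_gt (c^-1 ^+ n.+1 / n.+1%:R).
  have r0 : 0 < (x / c) ^+ n.+1 by rewrite exprn_gt0// (lt_trans _ r1).
  rewrite ler_pdivlMr// -[X in _ <= X]mul1r -ler_pdivrMr ?ltr0n// -mulrA.
  set K := cutoff_exp c n.
  have /andP[ya yb] := y01 n.
  (* Truncation loses less than one unit, hence at most [x ^+ n.+1 <= 1], which the summand 1
     absorbs. *)
  have H : (x / c) ^+ n.+1 / n.+1%:R <= 1 + K%:R * x ^+ n.+1.
    rewrite exprMn mulrAC -mulrA mulrC.
    apply: (@le_trans _ _ (K.+1%:R * x ^+ n.+1)).
      by rewrite ler_wpM2r// ltW// mulrC.
    by rewrite -nat1r mulrDl mul1r lerD2r.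
  apply: le_trans (expr_onem_mul_le1 _ K (y01 n)).
  by rewrite ler_wpM2l// exprn_ge0.
- exact: cvg_cst.
- exact: cvg_natr_div_exp.
Qed.

Lemma addeI_fin {R : realDomainType} (x y z : \bar R) : x \is a fin_num ->
  (x + y = x + z)%E -> y = z.
Proof. by move=> xfin /(congr1 (fun u => u - x)%E); rewrite !(addeC x) !addeK. Qed.

(** A binomial expansion would produce alternating sums of extended reals. A recursion in [K] needs
    only the cancellation of one finite term; it shifts [m] by [n], so [m] stays general. *)
Lemma eq_integral_onem_moments {R : realType} {d1 d2 : measure_display}
    {T1 : measurableType d1} {T2 : measurableType d2}
    (P1 : probability T1 R) (P2 : probability T2 R)
    (W1 U1 : T1 -> R) (W2 U2 : T2 -> R) (n : nat) :
  (forall x, 0 <= W1 x <= 1) -> (forall x, 0 <= W2 x <= 1) ->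
  measurable_fun setT W1 -> measurable_fun setT W2 ->
  (forall x, 0 <= U1 x <= 1) -> (forall x, 0 <= U2 x <= 1) ->
  measurable_fun setT U1 -> measurable_fun setT U2 ->
  (forall m, \int[P1]_x (W1 x * U1 x ^+ m)%:E =
             \int[P2]_x (W2 x * U2 x ^+ m)%:E)%E ->
  forall K m,
    (\int[P1]_x (W1 x * U1 x ^+ m * (1 - U1 x ^+ n) ^+ K)%:E =
     \int[P2]_x (W2 x * U2 x ^+ m * (1 - U2 x ^+ n) ^+ K)%:E)%E.
Proof.
move=> W101 W201 mW1 mW2 U101 U201 mU1 mU2 eqm.
pose J d (T : measurableType d) (P : probability T R) (W U : T -> R) m K :=
  (\int[P]_x (W x * U x ^+ m * (1 - U x ^+ n) ^+ K)%:E)%E.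
have aux d (T : measurableType d) (P : probability T R) (W U : T -> R) m K :
    (forall x, 0 <= W x <= 1) -> measurable_fun setT W ->
    (forall x, 0 <= U x <= 1) -> measurable_fun setT U ->
    J d T P W U m K \is a fin_num /\
    (J d T P W U m K.+1 + J d T P W U (m + n)%N K = J d T P W U m K)%E.
  move=> W01 mW U01 mU.
  have UX01 k x : 0 <= U x ^+ k <= 1.
    by have /andP[h0 h1] := U01 x; rewrite exprn_ge0//= exprn_ile1.
  have V01 k x : 0 <= (1 - U x ^+ n) ^+ k <= 1.
    have /andP[h0 h1] := UX01 n x.
    by rewrite exprn_ge0 ?subr_ge0//= exprn_ile1// ?subr_ge0// lerBlDr lerDl.
  have F01 k l x : 0 <= W x * U x ^+ k * (1 - U x ^+ n) ^+ l <= 1.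
    have /andP[a0 a1] := W01 x; have /andP[b0 b1] := UX01 k x.
    have /andP[c0 c1] := V01 l x.
    by rewrite !mulr_ge0//= mulr_ile1// ?mulr_ge0// mulr_ile1.
  have mF k l : measurable_fun setT
      (fun x => (W x * U x ^+ k * (1 - U x ^+ n) ^+ l)%:E).
    apply/measurable_EFinP; apply: measurable_funM.
      by apply: measurable_funM => //; exact: measurable_funX.
    by apply: measurable_funX; apply: measurable_funB => //; exact: measurable_funX.
  have F0 k l x : setT x -> (0 <= (W x * U x ^+ k * (1 - U x ^+ n) ^+ l)%:E)%E.
    by move=> _; rewrite lee_fin; have /andP[] := F01 k l x.
  split.
    rewrite /J ge0_fin_numE; last by apply: integral_ge0 => x; exact: F0.
    apply: (@le_lt_trans _ _ (\int[P]_x (cst 1%E) x)%E).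
      apply: ge0_le_integral => //.
      - by move=> x; exact: F0.
      - by move=> x _; rewrite lee_fin; have /andP[] := F01 m K x.
    rewrite integral_cst// mul1e.
    by apply: le_lt_trans (probability_le1 P measurableT) _; rewrite ltry.
  rewrite /J -ge0_integralD//; [|exact: F0..].
  apply: eq_integral => x _.
  by rewrite -EFinD; congr EFin; rewrite exprS exprD; ring.
(* All integrands are nonnegative: (1-U^n)^(K+1) U^m + (1-U^n)^K U^(m+n) = (1-U^n)^K U^m. *)
elim=> [|K IH] m.
  under eq_integral do rewrite mulr1.
  by under [RHS]eq_integral do rewrite mulr1.
have [_ e1] := aux _ _ P1 _ _ m K W101 mW1 U101 mU1.
have [_ e2] := aux _ _ P2 _ _ m K W201 mW2 U201 mU2.
have [f1 _] := aux _ _ P1 _ _ (m + n)%N K W101 mW1 U101 mU1.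
apply: (@addeI_fin _ (J _ _ P1 W1 U1 (m + n)%N K)) => //.
rewrite [LHS]addeC [LHS]e1 [X in (_ = X + _)%E]IH [RHS]addeC.
by rewrite [RHS]e2; exact: IH.
Qed.

(** Transforms at natural numbers are moments of [U = exp(-A)], which lies in [[0, 1]]. Polynomials
    in [U] bounded by 1 converge to the indicator of [U <= c], that is of [A >= - ln c], and closed
    upper half-lines form a pi-system generating the Borel sets. *)
Lemma laplace_unique {R : realType} {d1 d2 : measure_display}
    {T1 : measurableType d1} {T2 : measurableType d2}
    (P1 : probability T1 R) (P2 : probability T2 R)
    (W1 A1 : T1 -> R) (W2 A2 : T2 -> R) :
  (forall x, 0 <= W1 x <= 1) -> (forall x, 0 <= W2 x <= 1) ->
  measurable_fun setT W1 -> measurable_fun setT W2 ->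
  (forall x, 0 <= A1 x) -> (forall x, 0 <= A2 x) ->
  measurable_fun setT A1 -> measurable_fun setT A2 ->
  (forall m : nat, \int[P1]_x (W1 x * expR (- (m%:R * A1 x)))%:E =
                   \int[P2]_x (W2 x * expR (- (m%:R * A2 x)))%:E)%E ->
  forall B, measurable B ->
    (\int[P1]_(x in A1 @^-1` B) (W1 x)%:E =
     \int[P2]_(x in A2 @^-1` B) (W2 x)%:E)%E.
Proof.
move=> W101 W201 mW1 mW2 A10 A20 mA1 mA2 eqm.
pose U d (T : measurableType d) (A : T -> R) x := expR (- A x).
have mU d (T : measurableType d) (A : T -> R) :
    measurable_fun setT A -> measurable_fun setT (U d T A).
  by move=> mA; apply: measurableT_comp => //; exact: measurable_funN.
have U01 d (T : measurableType d) (A : T -> R) : (forall x, 0 <= A x) ->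
    forall x, 0 <= U d T A x <= 1.
  by move=> A0 x; rewrite expR_ge0 /= /U -expR0 ler_expR oppr_le0.
have eqU m : (\int[P1]_x (W1 x * U _ _ A1 x ^+ m)%:E =
    \int[P2]_x (W2 x * U _ _ A2 x ^+ m)%:E)%E.
  under eq_integral do rewrite -expRM_natl mulrN.
  by under [RHS]eq_integral do rewrite -expRM_natl mulrN.
have lim d (T : measurableType d) (P : probability T R) (W A : T -> R) c :
    (forall x, 0 <= W x <= 1) -> measurable_fun setT W ->
    (forall x, 0 <= A x) -> measurable_fun setT A -> 0 < c < 1 ->
    (\int[P]_x (W x * U _ _ A x ^+ 0 *
        (1 - U _ _ A x ^+ n.+1) ^+ cutoff_exp c n)%:E)%E @[n --> \oo] -->
    (\int[P]_x (W x * (U _ _ A x <= c)%R%:R)%:E)%E.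
  move=> W01 mW A0 mA c01.
  apply: (@dominated_cvg _ _ _ P setT measurableT _ _ (cst 1%E)) => //.
  - move=> n; apply/measurable_EFinP; apply: measurable_funM.
      by apply: measurable_funM => //; apply: measurable_funX; exact: mU.
    apply: measurable_funX; apply: measurable_funB => //.
    by apply: measurable_funX; exact: mU.
  - move=> x _; apply: cvg_EFin; first by apply: nearW.
    under eq_fun do rewrite /= mulr1.
    have cv := cvg_cutoff c _ c01 (U01 _ _ _ A0 x).
    exact: (@cvgMl_tmp _ _ _ _ _ (W x) _ cv).
  - exact: (@finite_measure_integrable_cst _ _ _ P _ 1).
  - move=> n x _; rewrite /= lee_fin expr0 mulr1.
    have /andP[a0 a1] := W01 x; have /andP[b0 b1] := U01 _ _ _ A0 x.
    have /andP[c0 c1] : 0 <= 1 - U _ _ A x ^+ n.+1 <= 1.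
      by rewrite subr_ge0 exprn_ile1//= lerBlDr lerDl exprn_ge0.
    rewrite ger0_norm ?mulr_ge0 ?exprn_ge0//.
    by rewrite mulr_ile1 ?exprn_ge0 ?exprn_ile1.
have eqc c : 0 < c < 1 ->
    (\int[P1]_x (W1 x * (U _ _ A1 x <= c)%R%:R)%:E =
     \int[P2]_x (W2 x * (U _ _ A2 x <= c)%R%:R)%:E)%E.
  move=> c01; have c1 := lim _ _ P1 _ _ c W101 mW1 A10 mA1 c01.
  have c2 := lim _ _ P2 _ _ c W201 mW2 A20 mA2 c01.
  apply: (cvg_unique _ c1) => //; apply: cvg_trans c2.
  apply: near_eq_cvg; apply: nearW => n.
  apply/esym/eq_integral_onem_moments => //; try exact: U01; try exact: mU.
(* The weighted measures need not have mass 1; their common mass, read off at [m = 0], settles the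
   whole space and the complements. *)
have eqT : (\int[P1]_x (W1 x)%:E = \int[P2]_x (W2 x)%:E)%E.
  have := eqm 0%N; under eq_integral do rewrite mul0r oppr0 expR0 mulr1.
  by under [RHS]eq_integral do rewrite mul0r oppr0 expR0 mulr1.
have fin d (T : measurableType d) (P : probability T R) (W : T -> R) S :
    (forall x, 0 <= W x <= 1) -> measurable_fun setT W -> measurable S ->
    (\int[P]_(x in S) (W x)%:E)%E \is a fin_num.
  move=> W01 mW mS; rewrite ge0_fin_numE; last first.
    by apply: integral_ge0 => x _; rewrite lee_fin; have /andP[] := W01 x.
  apply: (@le_lt_trans _ _ (\int[P]_(x in S) (cst 1%E) x)%E).
    apply: ge0_le_integral => //.
    - by move=> x _; rewrite lee_fin; have /andP[] := W01 x.
    - by apply/measurable_EFinP; exact: measurable_funTS.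
    - by move=> x _; rewrite lee_fin; have /andP[] := W01 x.
  rewrite integral_cst// mul1e.
  by apply: le_lt_trans (probability_le1 P mS) _; rewrite ltry.
move=> B mB.
pose Q := [set B : set R | (\int[P1]_(x in A1 @^-1` B) (W1 x)%:E =
     \int[P2]_(x in A2 @^-1` B) (W2 x)%:E)%E].
apply: (@dynkin_induction _ _ (@RGenCInfty.G R) Q).
- exact: RGenCInfty.measurableE.
- move=> _ _ [x ->] [y ->]; exists (Num.max x y).
  by apply/seteqP; split => z /=; rewrite !in_itv/= !andbT ge_max; [case=> -> ->|move=> /andP].
- by rewrite /Q /= !preimage_setT.
(* For [s > 0] the threshold [exp(-s)] lies strictly between 0 and 1; for [s <= 0] the half-line
   contains every value of [A]. *)
- move=> _ [s ->]; rewrite /Q /=; have [s0|s0] := ltP 0 s.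
    rewrite integral_EFin_indic [RHS]integral_EFin_indic.
    have E d (T : measurableType d) (A : T -> R) x :
        \1_(A @^-1` `[s, +oo[) x = (U _ _ A x <= expR (- s))%R%:R :> R.
      rewrite indicE /U ler_expR lerN2; congr (nat_of_bool _)%:R.
      by apply/idP/idP; rewrite inE /= in_itv/= andbT.
    under eq_integral do rewrite E; under [RHS]eq_integral do rewrite E.
    by apply: eqc; rewrite expR_gt0 -expR0 ltr_expR oppr_lt0.
  have E d (T : measurableType d) (A : T -> R) : (forall x, 0 <= A x) ->
      A @^-1` `[s, +oo[ = setT.
    move=> A0; apply/seteqP; split => x //= _; rewrite in_itv/= andbT.
    exact: le_trans s0 (A0 x).
  by rewrite !E.
- move=> S mS; rewrite /Q /= => eqS.
  have H d (T : measurableType d) (P : probability T R) (W A : T -> R) :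
      (forall x, 0 <= W x <= 1) -> measurable_fun setT W -> measurable_fun setT A ->
      (\int[P]_x (W x)%:E = \int[P]_(x in A @^-1` S) (W x)%:E +
        \int[P]_(x in A @^-1` (~` S)) (W x)%:E)%E.
    move=> W01 mW mA; rewrite -ge0_integral_setU//.
    + by rewrite -preimage_setU setUCr.
    + exact: measurable_preimage.
    + by apply: measurable_preimage => //; exact: measurableC.
    + by apply/measurable_EFinP; exact: measurable_funTS.
    + by move=> x _; rewrite lee_fin; have /andP[] := W01 x.
    + by apply/disj_setPS => x [].
  move: eqT; rewrite (H _ _ P1 W1 A1)// (H _ _ P2 W2 A2)// eqS.
  apply: (addeI_fin _ _ _ _) => //.
  by apply: fin => //; exact: measurable_preimage.
- move=> F mF tF FQ; rewrite /Q /= !preimage_bigcup.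
  have H d (T : measurableType d) (P : probability T R) (W A : T -> R) :
      (forall x, 0 <= W x <= 1) -> measurable_fun setT W -> measurable_fun setT A ->
      (\int[P]_(x in \bigcup_n (A @^-1` F n)) (W x)%:E =
       \sum_(n <oo) \int[P]_(x in A @^-1` F n) (W x)%:E)%E.
    move=> W01 mW mA; apply: ge0_integral_bigcup.
    + by move=> n; exact: measurable_preimage.
    + by apply/measurable_EFinP; exact: measurable_funTS.
    + by move=> x _; rewrite lee_fin; have /andP[] := W01 x.
    + by move=> i j _ _ [x [xi xj]]; apply: tF => //; exists (A x).
  by rewrite !H//; apply: eq_eseriesr => n _; exact: FQ.
- exact: (eq_ind _ (fun F => F B) mB _ (RGenCInfty.measurableE R)).
Qed.

(** * Riemann sums of cadlag functions *)

(** One-sided limits bound [f] near each point, and compactness makes the bound uniform. Local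
    bounds are restricted to nonnegative times because [cadlag] does not control [f] at negative
    ones. *)
Lemma cadlag_bounded {R : realType} (f : R -> R) (T : R) : cadlag f ->
  exists C, forall s, 0 <= s <= T -> `|f s| <= C.
Proof.
move=> [fr fl].
have loc (x : R) : 0 <= x -> exists C, \forall x' \near x, 0 <= x' -> `|f x'| <= C.
  move=> x0; have R1 : \forall x' \near x, x < x' -> `|f x'| <= `|f x| + 1.
    have h : \forall y \near x^'+, `|f y| <= `|f x| + 1.
      by apply: (cvgr_norm_le (f x) (fr x x0)); rewrite ltrDl.
    exact: h.
  have [L HL] : exists L, \forall x' \near x, 0 <= x' < x -> `|f x'| <= L.
    (* At [x = 0] no left limit is given, but then no [x'] satisfies [0 <= x' < x]. *)
    have [x_gt0|x_le0] := ltP 0 x; last first.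
      exists 0; apply: (@filterE _ (nbhs x)) => y /andP[y0 yx].
      by move: (le_lt_trans y0 yx); rewrite ltNge x_le0.
    exists (`|lim (f @ x^'-)| + 1).
    have : \forall x' \near x, x' < x -> `|f x'| <= `|lim (f @ x^'-)| + 1.
      have h : \forall y \near x^'-, `|f y| <= `|lim (f @ x^'-)| + 1.
        by apply: (cvgr_norm_le _ (fl x x_gt0)); rewrite ltrDl.
      exact: h.
    by apply: filterS => y h /andP[_ /h].
  exists (Num.max (`|f x| + 1) L).
  near=> y => y0; have [xy|yx|->] := ltgtP x y.
  - by rewrite le_max (near R1 y)//.
  - by rewrite le_max (near HL y) ?orbT// y0.
  - by rewrite le_max lerDl ler01.
have /compact_near_coveringP nc := @segment_compact R 0 T.
have [] := nc R +oo%R (fun C x => 0 <= x -> `|f x| <= C) _ _.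
  move=> x /=; rewrite in_itv/= => /andP[x0 _]; have [C HC] := loc x x0.
  exists ([set x' | 0 <= x' -> `|f x'| <= C], [set i | C <= i]).
    by split => //=; apply: nbhs_pinfty_ge; exact: num_real.
  by move=> [y i] /= [h Ci] y0; rewrite (le_trans (h y0)).
move=> M [Mreal HM]; exists (M + 1) => s /andP[s0 sT].
by apply: (HM (M + 1)) => //=; [rewrite ltrDl|rewrite in_itv/= s0].
Unshelve. all: by end_near. Qed.

(** Sums at right endpoints are integrals of step functions that converge to [f] at every point of
    [[0, T]] by right-continuity alone. This also yields measurability, and boundedness allows
    dominated convergence. *)
Lemma cvg_riemann_cadlag {R : realType} (f : R -> R) (T : R) : 0 < T ->
  (forall s, 0 <= f s) -> cadlag f ->
  [/\ measurable_fun `[0, T] f,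
      lebesgue_measure.-integrable `[0, T] (EFin \o f) &
      T / n.+1%:R * \sum_(i < n.+1) f (T * i.+1%:R / n.+1%:R) @[n --> \oo] -->
      fine (\int[lebesgue_measure]_(s in `[0%R, T]) (f s)%:E)%E].
Proof.
move=> T0 f0 cf; have [C HC] := cadlag_bounded f T cf.
have [fr _] := cf.
pose a n i := T * i%:R / n.+1%:R : R.
have a_ge0 n i : 0 <= a n i by rewrite /a divr_ge0// mulr_ge0// ltW.
have aS n i : a n i.+1 - a n i = T / n.+1%:R.
  by rewrite /a -mulrBl -mulrBr -natr1 [i%:R + 1]addrC addrK mulr1.
have a_lt n i : a n i < a n i.+1 by rewrite -subr_gt0 aS divr_gt0.
(* Cells are open on the right so that the sampled endpoint [x s n] is strictly beyond [s], as
   [at_right] requires. The point [T] lies in no cell and gets its own term, whose integral is 0. *)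
pose F n s := \sum_(i < n.+1) f (a n i.+1) * \1_(`[a n i, a n i.+1[%classic) s
  + f T * \1_[set T] s.
pose x s n := a n (Num.truncn (s * n.+1%:R / T)).+1.
have x_itv s n : 0 <= s -> a n (Num.truncn (s * n.+1%:R / T)) <= s < x s n.
  move=> s0; have /truncn_itv/andP[h1 h2] : 0 <= s * n.+1%:R / T.
    by rewrite divr_ge0 ?mulr_ge0// ltW.
  rewrite /x /a ler_pdivrMr// ltr_pdivlMr//.
  by move: h1 h2; rewrite ler_pdivlMr// ltr_pdivrMr// ![_ * T]mulrC => -> ->.
have kn s n : s < T -> (Num.truncn (s * n.+1%:R / T) < n.+1)%N.
  by move=> sT; rewrite ltnS truncn_le_nat ltr_pdivrMr// mulrC ltr_pM2l.
have aT n i : (i < n.+1)%N -> a n i.+1 <= T.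
  by move=> ni; rewrite /a ler_pdivrMr// ler_pM2l// ler_nat.
have FT n : F n T = f T.
  rewrite /F indicE mem_set// mulr1 big1 ?add0r// => i _.
  rewrite indicE memNset ?mulr0//= in_itv/= => /andP[_].
  by rewrite ltNge aT.
have FE s n : 0 <= s -> s < T -> F n s = f (x s n).
  move=> s0 sT; rewrite /F indicE memNset; last by move=> /= sE; rewrite sE ltxx in sT.
  rewrite mulr0 addr0.
  rewrite (bigD1 (Ordinal (kn s n sT)))//= indicE mem_set; last first.
    by rewrite /= in_itv/=; exact: x_itv.
  rewrite mulr1 big1 ?addr0// => i ik; rewrite indicE memNset ?mulr0//=.
  rewrite in_itv/= /a ler_pdivrMr// ltr_pdivlMr// => /andP[h1 h2].
  move: ik; rewrite -val_eqE /= (@truncn_def _ _ i) ?eqxx//.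
  by rewrite ler_pdivlMr// ltr_pdivrMr// ![_ * T]mulrC h1 h2.
have Ff s : 0 <= s <= T -> F n s @[n --> \oo] --> f s.
  move=> /andP[s0]; rewrite le_eqVlt => /predU1P[sT|sT].
    rewrite sT (_ : (fun n => F n T) = cst (f T)); first exact: cvg_cst.
    by apply/funext => n; rewrite FT.
  rewrite (_ : (fun n => F n s) = f \o x s); last by apply/funext => n; rewrite FE.
  have /cvg_at_rightP := fr s s0; apply; split.
    by move=> n; have /andP[] := x_itv s n s0.
  apply: (@squeeze_cvgr _ _ _ _ (cst s) (fun n => s + T * harmonic n)).
  - apply: nearW => n; have /andP[h1 h2] := x_itv s n s0; rewrite ltW//=.
    by rewrite -lerBlDl (le_trans (lerB (lexx _) h1))// aS.
  - exact: cvg_cst.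
  - rewrite -[X in _ --> X]addr0 -[X in _ --> _ + X](mulr0 T).
    by apply: cvgD; [exact: cvg_cst|apply: cvgMl_tmp; exact: cvg_harmonic].
have mF n : measurable_fun setT (F n).
  apply: measurable_funD; last first.
    by apply: measurable_funM => //; exact: measurable_indic.
  by apply: measurable_sum => i; exact: measurable_funM.
have F_ge0 n s : 0 <= F n s.
  rewrite /F addr_ge0// ?mulr_ge0//.
  by apply: sumr_ge0 => i _; rewrite mulr_ge0.
have mf : measurable_fun `[0, T] f.
  apply: (@measurable_fun_cvg _ _ _ _ F).
    by move=> n; exact: measurable_funTS.
  by move=> s /=; rewrite in_itv/=; exact: Ff.
have C0 : 0 <= C by apply: le_trans (HC 0 _); rewrite ?lexx//= ltW.
have cstI : lebesgue_measure.-integrable `[0, T] (EFin \o cst C).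
  apply/integrableP; split; first exact/measurable_EFinP.
  under eq_integral do rewrite /= ger0_norm//.
  by rewrite integral_cst//= lebesgue_measure_itv/= lte_fin T0 -EFinD -EFinM ltry.
have intf : lebesgue_measure.-integrable `[0, T] (EFin \o f).
  apply: le_integrable cstI => //.
    exact/measurable_EFinP.
  by move=> s /=; rewrite in_itv/= => sT; rewrite lee_fin [leRHS]ger0_norm//; exact: HC.
split => //.
have intF n : (\int[lebesgue_measure]_(s in `[0%R, T]) (F n s)%:E =
   (T / n.+1%:R * \sum_(i < n.+1) f (a n i.+1))%:E)%E.
  have intI (c : R) (A : set R) : 0 <= c -> measurable A ->
      (\int[lebesgue_measure]_(s in `[0%R, T]) (c * \1_A s)%:E =
       c%:E * lebesgue_measure (A `&` `[0%R, T]))%E.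
    move=> c0 mA; under eq_integral do rewrite EFinM.
    rewrite ge0_integralZl//; first by rewrite integral_indic.
    by apply/measurable_EFinP; exact: measurable_indic.
  under eq_integral do rewrite EFinD -sumEFin.
  rewrite ge0_integralD//; last 4 first.
  - by move=> s _; rewrite sume_ge0// => i _; rewrite lee_fin mulr_ge0.
  - apply: emeasurable_sum => i; apply/measurable_EFinP.
    by apply: measurable_funM => //; exact: measurable_indic.
  - by move=> s _; rewrite lee_fin mulr_ge0.
  - apply/measurable_EFinP.
    by apply: measurable_funM => //; exact: measurable_indic.
  rewrite intI// (_ : [set T] `&` `[0, T] = [set T]); last first.
    by apply/seteqP; split => [s []//|s /= ->]; split => //; rewrite in_itv/= lexx ltW.
  rewrite [X in (_ + _ * X)%E]lebesgue_measure_set1 mule0 adde0.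
  rewrite ge0_integral_sum//; last 2 first.
  - move=> i; apply/measurable_EFinP.
    by apply: measurable_funM => //; exact: measurable_indic.
  - by move=> i s _; rewrite lee_fin mulr_ge0.
  rewrite mulr_sumr -sumEFin; apply: eq_bigr => i _; rewrite intI//.
  rewrite (_ : `[a n i, a n i.+1[ `&` `[0, T] = `[a n i, a n i.+1[%classic); last first.
    apply/seteqP; split => [s []//|s /= h]; split => //.
    move: h; rewrite !in_itv/= => /andP[h1 h2].
    by rewrite (le_trans _ h1)//= (le_trans (ltW h2))// aT.
  rewrite lebesgue_measure_itv/= lte_fin a_lt -EFinD aS -EFinM.
  by rewrite mulrC.
rewrite -[X in X @ _ --> _](_ : (fun n => fine (\int[lebesgue_measure]_(s in `[0%R, T]) (F n s)%:E)%E) = _); last first.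
  by apply/funext => n; rewrite intF.
apply: fine_cvg; rewrite fineK; last exact: integrable_fin_num.
apply: (@dominated_cvg _ _ _ lebesgue_measure _ _ _ _ (EFin \o cst C)) => //.
- move=> n; apply/measurable_EFinP. apply: measurable_funTS; exact: mF.
- move=> s /=; rewrite in_itv/= => sT; apply: cvg_EFin; first exact: nearW.
  exact: Ff.
- move=> n s /=; rewrite in_itv/= => /andP[s0]; rewrite lee_fin ger0_norm//.
  rewrite le_eqVlt => /predU1P[sT|sT].
    by rewrite sT FT (le_trans (ler_norm _))// HC// ltW//= lexx.
  rewrite FE// (le_trans (ler_norm _))// HC//.
  by rewrite a_ge0/= aT// kn.
Qed.

(** * Laplace transform of a time average *)

Lemma eq_in_law_integral {R : realType} {d1 d2 : measure_display}
    {T1 : measurableType d1} {T2 : measurableType d2}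
    (P1 : probability T1 R) (P2 : probability T2 R)
    (X1 : T1 -> R) (X2 : T2 -> R) (g : R -> R) :
  measurable_fun setT X1 -> measurable_fun setT X2 -> eq_in_law P1 P2 X1 X2 ->
  (forall x, 0 <= g x) -> measurable_fun setT g ->
  (\int[P1]_x (g (X1 x))%:E = \int[P2]_x (g (X2 x))%:E)%E.
Proof.
move=> mX1 mX2 eqX g0 mg.
have := @eq_weighted_integral R _ _ _ _ P1 P2 (fun=> 1) (fun=> 1) X1 X2 g.
under eq_integral do rewrite mul1r; under [in RHS]eq_integral do rewrite mul1r.
apply => //.
move=> B mB; rewrite !integral_cst; [|exact: measurable_preimage..].
by rewrite !mul1e; exact: eqX.
Qed.

Lemma cvg_expR {R : realType} (u : R ^nat) (l : R) :
  u @ \oo --> l -> expR (u n) @[n --> \oo] --> expR l.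
Proof. by move=> ul; apply: cvg_comp ul _; exact: continuous_expR. Qed.

(** Summation by parts: it turns a sum of dependent path values into a weighted sum of increments,
    which are independent. *)
Lemma sum_abel {R : comRingType} (y : nat -> R) (m : nat) : y 0%N = 0 ->
  \sum_(i < m) y i.+1 = \sum_(i < m) (m - i)%:R * (y i.+1 - y i).
Proof.
move=> y0; elim: m => [|m IH]; first by rewrite !big_ord0.
rewrite big_ord_recr [RHS]big_ord_recr/= subSnn mul1r IH.
under [in RHS]eq_bigr => i _ do rewrite subSn 1?ltnW// -natr1 mulrDl mul1r.
rewrite big_split/= -addrA; congr (_ + _).
rewrite -(big_mkord xpredT (fun i => y i.+1 - y i)) telescope_sumr// y0 subr0.
by rewrite addrC subrK.
Qed.

Lemma cadlag_expRN {R : realType} (a : R) : cadlag (fun x => expR (- (a * x))).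
Proof.
have c (x : R) : (fun x => expR (- (a * x))) @ x --> expR (- (a * x)).
  apply: continuous_comp; last exact: continuous_expR.
  by apply: cvgN; apply: cvgMl_tmp; exact: cvg_id.
split => t _; first exact: cvg_at_right_filter.
by apply/cvgP; apply: cvg_at_left_filter; exact: c.
Qed.

(* The Laplace transform at [a] of the uniform law on [0, j]. *)
Definition unif_laplace {R : realType} (a : R) (j : nat) : R :=
  j%:R^-1 * fine (\int[lebesgue_measure]_(x in `[0%R, j%:R]) (expR (- (a * x)))%:E)%E.

(** The left side is what jumps of size [j] contribute to the exponent in the transform of a Riemann
    mean. Keeping the limit as an integral avoids the formula [(1 - exp(-a j)) / (a j)], which
    breaks down at [a = 0]. *)
Lemma cvg_unif_laplace {R : realType} (a : R) (j : nat) : (0 < j)%N ->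
  n.+1%:R^-1 * \sum_(i < n.+1) expR (- (a * (i.+1%:R / n.+1%:R))) ^+ j
    @[n --> \oo] --> unif_laplace a j.
Proof.
move=> j0; have jR : 0 < j%:R :> R by rewrite ltr0n.
have [_ _ cv] := cvg_riemann_cadlag (fun x => expR (- (a * x))) j%:R jR
  (fun=> expR_ge0 _) (cadlag_expRN a).
rewrite /unif_laplace.
rewrite (_ : (fun n => _) = (fun n => j%:R^-1 * (j%:R / n.+1%:R *
    \sum_(i < n.+1) expR (- (a * (j%:R * i.+1%:R / n.+1%:R)))))); last first.
  apply/funext => n; rewrite !mulrA mulVf ?gt_eqF// mul1r; congr (_ * _).
  apply: eq_bigr => i _; rewrite -expRM_natl; congr expR.
  by rewrite mulrN !mulrA [_ * a]mulrC.
exact: (@cvgMl_tmp _ _ _ _ _ j%:R^-1 _ cv).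
Qed.

Definition time_mean {R : realType} {Omega : Type} (M : R -> Omega -> nat) (t : R)
    (w : Omega) : R :=
  t^-1 * fine (\int[lebesgue_measure]_(s in `[0%R, t]) ((M s w)%:R : R)%:E)%E.

Section time_mean.
Context {R : realType} {d : measure_display} {Omega : measurableType d}.
Context (P : probability Omega R) (M : R -> Omega -> nat).
Hypothesis levyM : levy_nat P M.
Variable t : R.
Hypothesis t0 : 0 < t.

Definition riemann_mean (n : nat) (w : Omega) : R :=
  n.+1%:R^-1 * \sum_(i < n.+1) (M (t * i.+1%:R / n.+1%:R) w)%:R.

Lemma cvg_riemann_mean w : riemann_mean n w @[n --> \oo] --> time_mean M t w.
Proof.
have [_ _ cM _ _] := levyM.
have [_ _ cv] := cvg_riemann_cadlag (fun s => (M s w)%:R) t t0 (fun=> ler0n _ _) (cM w).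
rewrite /time_mean.
rewrite (_ : (fun n => _) = (fun n => t^-1 * (t / n.+1%:R *
    \sum_(i < n.+1) (M (t * i.+1%:R / n.+1%:R) w)%:R))); last first.
  by apply/funext => n; rewrite !mulrA mulVf ?gt_eqF// mul1r.
exact: (@cvgMl_tmp _ _ _ _ _ t^-1 _ cv).
Qed.

Lemma time_mean_ge0 w : 0 <= time_mean M t w.
Proof.
rewrite /time_mean mulr_ge0 ?invr_ge0 ?(ltW t0)// fine_ge0//.
by apply: integral_ge0 => s _; rewrite lee_fin.
Qed.

Lemma time_grid_ge0 (i n : nat) : 0 <= t * i%:R / n%:R.
Proof. by rewrite divr_ge0// mulr_ge0// ltW. Qed.

Lemma measurable_riemann_mean n : measurable_fun setT (riemann_mean n).
Proof.
have [mM _ _ _ _] := levyM.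
apply: measurable_funM => //; apply: measurable_sum => i.
by apply: mM; exact: time_grid_ge0.
Qed.

Lemma measurable_time_mean : measurable_fun setT (time_mean M t).
Proof.
apply: (measurable_fun_cvg measurable_riemann_mean).
by move=> w _; exact: cvg_riemann_mean.
Qed.

(** Independence of the two processes is given for the sigma-algebras of their values at nonnegative
    times; the average is measurable there as a pointwise limit of finite combinations of such
    values. *)
Lemma time_mean_sigma_fam B : measurable B ->
  sigma_fam [set s : R | 0 <= s] (fun s w => (M s w)%:R : R) (time_mean M t @^-1` B).
Proof.
move=> mB.
pose G := \bigcup_(s in [set s : R | 0 <= s])
  sigma_of (fun w : Omega => (M s w)%:R : R).
have mG s : 0 <= s ->
    measurable_fun [set: g_sigma_algebraType G] (fun w => (M s w)%:R : R).
  move=> s0 _ C mC; apply: sub_sigma_algebra; exists s => //.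
  by exists C.
have : measurable_fun [set: g_sigma_algebraType G] (time_mean M t).
  apply: (@measurable_fun_cvg _ (g_sigma_algebraType G) _ _ riemann_mean); last first.
    by move=> w _; exact: cvg_riemann_mean.
  move=> n; apply: measurable_funM => //; apply: measurable_sum => i.
  by apply: mG; exact: time_grid_ge0.
by move=> /(_ measurableT B mB); rewrite setTI.
Qed.

Variables (k : nat) (lam : nat -> R).
Hypothesis pgfM : forall t u, 0 <= t -> 0 <= u <= 1 ->
    (\int[P]_w (u ^+ M t w)%:E)%E =
    (expR (t * \sum_(1 <= j < k.+1) lam j * (u ^+ j - 1)))%:E.

Lemma laplace_riemann_mean (a : R) n : 0 <= a ->
  (\int[P]_w (expR (- (a * riemann_mean n w)))%:E =
   (expR (t * \sum_(1 <= j < k.+1) lam j *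
     (n.+1%:R^-1 * \sum_(i < n.+1) expR (- (a * (i.+1%:R / n.+1%:R))) ^+ j - 1)))%:E)%E.
Proof.
move=> a0; have [mM M0 _ indM statM] := levyM.
pose tt (i : nat) := t * i%:R / n.+1%:R.
have tt0 i : 0 <= tt i by exact: time_grid_ge0.
pose Y (i : 'I_n.+1) w : R := (M (tt i.+1) w)%:R - (M (tt i) w)%:R.
have mY i : measurable_fun setT (Y i).
  by apply: measurable_funB; exact: mM.
(* The weight that summation by parts gives to the [i]-th increment. *)
pose c (i : 'I_n.+1) := a * ((n.+1 - i)%:R / n.+1%:R).
have c0 i : 0 <= c i by rewrite /c mulr_ge0// divr_ge0.
pose g (i : 'I_n.+1) x := expR (- (c i * x)).
have mg i : measurable_fun setT (g i).
  apply: measurableT_comp => //; apply: measurable_funN.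
  exact: measurable_funM.
(* By stationarity, the generating function at time [t / n.+1] and [u = exp(- c i)]. *)
pose p (i : 'I_n.+1) := expR (t / n.+1%:R *
  \sum_(1 <= j < k.+1) lam j * (expR (- c i) ^+ j - 1)).
have gp i : (\int[P]_w (g i (Y i w))%:E = (p i)%:E)%E.
  rewrite /p -pgfM ?divr_ge0 ?(ltW t0)//; last first.
    by rewrite expR_ge0/= -expR0 ler_expR oppr_le0.
  have ttS : tt i.+1 = t / n.+1%:R + tt i.
    by rewrite /tt -natr1; ring.
  rewrite (@eq_in_law_integral _ _ _ _ _ P P _
    (fun w => (M (t / n.+1%:R) w)%:R - (M 0 w)%:R))//.
  - apply: eq_integral => w _; rewrite /g M0 subr0 -expRM_natl; congr (expR _)%:E.
    by rewrite mulrN mulrC.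
  - by apply: measurable_funB; apply: mM => //; rewrite divr_ge0// ltW.
  - by rewrite /Y ttS; apply: statM => //; rewrite divr_ge0// ltW.
  - by move=> x; exact: expR_ge0.
have uI : uniq (index_enum 'I_n.+1) by exact: index_enum_uniq.
have indY : indep_family P (fun i => sigma_of (Y i)).
  apply: (indM n.+1 tt) => //.
  by move=> i _; rewrite /tt ler_wpM2r// ler_wpM2l ?ler_nat// ltW.
have E := indep_integral_prod P Y g p (index_enum 'I_n.+1) mY
  (fun i x => expR_ge0 _) mg gp indY uI.
transitivity (\int[P]_w (\prod_(i < n.+1) g i (Y i w))%:E)%E.
  apply: eq_integral => w _; congr EFin.
  rewrite /g -expR_sum; congr expR.
  rewrite sumrN; congr (- _); rewrite /riemann_mean.
  rewrite (sum_abel (fun i => (M (tt i) w)%:R)); last first.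
    by rewrite /tt mulr0 mul0r M0.
  rewrite mulrA mulr_sumr; apply: eq_bigr => i _.
  by rewrite /c /Y; ring.
rewrite E /p -expR_sum; congr (expR _)%:E.
rewrite -mulr_sumr -mulrA; congr (_ * _).
rewrite exchange_big/= mulr_sumr; apply: eq_bigr => j _.
rewrite -mulr_sumr mulrCA; congr (_ * _).
rewrite big_split/= sumr_const card_ord mulrDr; congr (_ + _).
  (* The factors [n.+1 - i] run down from [n.+1] to 1; reversal turns them into [i.+1]. *)
  congr (_ * _); rewrite (reindex_inj rev_ord_inj)/=; apply: eq_bigr => i _.
  by rewrite /c /= subKn.
by rewrite mulNrn mulrN mulVf.
Qed.

Lemma laplace_time_mean (a : R) : 0 <= a ->
  (\int[P]_w (expR (- (a * time_mean M t w)))%:E =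
   (expR (t * \sum_(1 <= j < k.+1) lam j * (unif_laplace a j - 1)))%:E)%E.
Proof.
move=> a0.
have c1 : (\int[P]_w (expR (- (a * riemann_mean n w)))%:E)%E @[n --> \oo] -->
    (\int[P]_w (expR (- (a * time_mean M t w)))%:E)%E.
  apply: (@dominated_cvg _ _ _ P setT measurableT _ _ (cst 1%E)) => //.
  - move=> n; apply/measurable_EFinP; apply: measurableT_comp => //.
    by apply: measurable_funN; apply: measurable_funM => //; exact: measurable_riemann_mean.
  - move=> w _; apply: cvg_EFin; first by apply: nearW.
    apply: cvg_expR; apply: cvgN; apply: cvgMl_tmp.
    exact: cvg_riemann_mean.
  - exact: (@finite_measure_integrable_cst _ _ _ P _ 1).
  - move=> n w _; rewrite /= lee_fin ger0_norm ?expR_ge0// -expR0 ler_expR oppr_le0.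
    by rewrite mulr_ge0// mulr_ge0// sumr_ge0.
apply: (cvg_unique _ c1) => //.
rewrite (funext (fun n => laplace_riemann_mean a n a0)).
apply: cvg_EFin; first by apply: nearW.
apply: cvg_expR; apply: cvgMl_tmp; rewrite big_nat.
under eq_fun do rewrite big_nat.
apply: cvg_big => [|j /andP[j0 _]]; first exact: add_continuous.
apply: cvgMl_tmp; apply: cvgB; last exact: cvg_cst.
exact: cvg_unif_laplace.
Qed.

End time_mean.

(** * Laplace transform of the jumps *)

(** The integrand of the joint transform of the positive and negative parts, written as one function
    of the jump so that its product over the jumps gives the joint transform of the two sums. *)
Definition laplace_parts {R : realType} (a b x : R) : R :=
  expR (- (a * Num.max x 0) - b * Num.max (- x) 0).

Lemma laplace_parts_ge0 {R : realType} (a b x : R) : 0 <= laplace_parts a b x.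
Proof. exact: expR_ge0. Qed.

Lemma measurable_pos_part {R : realType} :
  measurable_fun setT (fun x : R => Num.max x 0).
Proof. by apply: measurable_maxr. Qed.

Lemma measurable_neg_part {R : realType} :
  measurable_fun setT (fun x : R => Num.max (- x) 0).
Proof. by apply: measurable_maxr => //; exact: measurable_funN. Qed.

Lemma measurable_laplace_parts {R : realType} (a b : R) :
  measurable_fun setT (laplace_parts a b).
Proof.
apply: measurableT_comp => //; apply: measurable_funB.
  by apply: measurable_funN; apply: measurable_funM => //; exact: measurable_pos_part.
by apply: measurable_funM => //; exact: measurable_neg_part.
Qed.

Lemma integral_expRN {R : realType} (a : R) (j : nat) : (0 < j)%N ->
  (\int[lebesgue_measure]_(x in `[0%R, j%:R]) (expR (- (a * x)))%:E =
   (j%:R * unif_laplace a j)%:E)%E.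
Proof.
move=> j0; have jR : 0 < j%:R :> R by rewrite ltr0n.
have [_ intf _] := cvg_riemann_cadlag (fun x => expR (- (a * x))) j%:R jR
  (fun=> expR_ge0 _) (cadlag_expRN a).
rewrite /unif_laplace mulrA mulfV ?gt_eqF// mul1r fineK//.
exact: integrable_fin_num.
Qed.

Lemma integral_laplace_parts_pos {R : realType} (a b : R) (j : nat) : (0 < j)%N ->
  (\int[lebesgue_measure]_(x in `[0%R, j%:R]) (laplace_parts a b x)%:E =
   (j%:R * unif_laplace a j)%:E)%E.
Proof.
move=> j0; rewrite -integral_expRN//; apply: eq_integral => x.
rewrite inE/= in_itv/= => /andP[x0 _]; congr (expR _)%:E.
by rewrite max_l// max_r ?oppr_le0// mulr0 subr0.
Qed.

Lemma integral_laplace_parts_neg {R : realType} (a b : R) (j : nat) : (0 < j)%N ->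
  (\int[lebesgue_measure]_(x in `[(- j%:R)%R, 0%R]) (laplace_parts a b x)%:E =
   (j%:R * unif_laplace b j)%:E)%E.
Proof.
move=> j0.
(* The endpoint is written [- 0] to fit the substitution of [- x] for [x]. *)
transitivity (\int[lebesgue_measure]_(x in `[(- j%:R)%R, (- 0)%R])
    (expR (b * x))%:E : \bar R)%E.
  rewrite oppr0; apply: eq_integral => x.
  rewrite inE/= in_itv/= => /andP[_ x0]; congr (expR _)%:E.
  by rewrite max_r// max_l ?oppr_ge0// mulr0 oppr0 add0r mulrN opprK.
rewrite integration_by_substitution_oppr//.
- rewrite -integral_expRN//; apply: eq_integral => x _ /=.
  by rewrite mulrN.
- apply: continuous_subspaceT => x; apply: continuous_comp; last exact: continuous_expR.
  by apply: cvgMl_tmp; exact: cvg_id.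
Qed.

Lemma gsp_density_ge0 {R : realType} (k : nat) (lam mu : nat -> R) (x : R) :
  (forall j, (1 <= j <= k)%N -> 0 <= lam j) ->
  (forall j, (1 <= j <= k)%N -> 0 <= mu j) -> 0 <= gsp_density k lam mu x.
Proof.
move=> lam0 mu0; have sum0 (F : nat -> R) :
    (forall j, (1 <= j <= k)%N -> 0 <= F j) -> 0 <= \sum_(1 <= j < k.+1) F j.
  by move=> F0; rewrite big_nat; apply: sumr_ge0 => j; exact: F0.
have nu0 : 0 <= (\sum_(1 <= j < k.+1) lam j + \sum_(1 <= j < k.+1) mu j)^-1.
  by rewrite invr_ge0 addr_ge0// sum0.
by rewrite /gsp_density addr_ge0// mulr_ge0//; apply: sum0 => j jk;
  rewrite mulr_ge0//; [rewrite divr_ge0// lam0|case: ifP|rewrite divr_ge0// mu0|case: ifP].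
Qed.

Lemma measurable_gsp_density {R : realType} (k : nat) (lam mu : nat -> R) :
  measurable_fun setT (gsp_density k lam mu).
Proof.
have mI (A : interval R) : measurable_fun setT (fun x : R => if x \in A then 1 else 0 : R).
  rewrite (_ : (fun x => _) = \1_[set` A]); first exact: measurable_indic.
  by apply/funext => x; rewrite indicE mem_setE; case: ifP.
apply: measurable_funD; apply: measurable_funM => //; apply: measurable_sum => j;
  apply: measurable_funM => //.
  exact: (mI `[0, j%:R]%R).
exact: (mI `[- j%:R, 0]%R).
Qed.

(** On the support of each component of the density only one of [a], [b] matters, so the two
    arguments separate additively. *)
Lemma integral_gsp_density {R : realType} (k : nat) (lam mu : nat -> R) (a b : R) :
  let nu := \sum_(1 <= j < k.+1) lam j + \sum_(1 <= j < k.+1) mu j in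
  (forall j, (1 <= j <= k)%N -> 0 <= lam j) ->
  (forall j, (1 <= j <= k)%N -> 0 <= mu j) ->
  0 < nu ->
  (\int[lebesgue_measure]_x (gsp_density k lam mu x * laplace_parts a b x)%:E =
   (nu^-1 * (\sum_(1 <= j < k.+1) lam j * unif_laplace a j +
             \sum_(1 <= j < k.+1) mu j * unif_laplace b j))%:E)%E.
Proof.
move=> nu lam0 mu0 nu0.
have toord (F : nat -> R) : \sum_(1 <= j < k.+1) F j = \sum_(i < k) F i.+1.
  by rewrite big_add1/= big_mkord.
have lam0' (i : 'I_k) : 0 <= lam i.+1 by apply: lam0; rewrite ltn_ord.
have mu0' (i : 'I_k) : 0 <= mu i.+1 by apply: mu0; rewrite ltn_ord.
have piece (c : R) (A : interval R) : 0 <= c ->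
    (\int[lebesgue_measure]_x (c * (\1_[set` A] x * laplace_parts a b x))%:E =
     c%:E * \int[lebesgue_measure]_(x in [set` A]) (laplace_parts a b x)%:E)%E.
  move=> c0; under eq_integral do rewrite EFinM.
  rewrite ge0_integralZl//; last 2 first.
  - apply/measurable_EFinP; apply: measurable_funM; last exact: measurable_laplace_parts.
    exact: measurable_indic.
  - by move=> x _; rewrite lee_fin mulr_ge0// laplace_parts_ge0.
  rewrite [in RHS]integral_EFin_indic; congr (_ * _)%E.
  by apply: eq_integral => x _; rewrite mulrC.
have m_piece (c : R) (A : interval R) : measurable_fun setT
    (fun x => (c * (\1_[set` A] x * laplace_parts a b x))%:E).
  apply/measurable_EFinP; apply: measurable_funM => //.
  apply: measurable_funM; last exact: measurable_laplace_parts.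
  exact: measurable_indic.
have p_ge0 (c : R) (A : interval R) x : 0 <= c ->
    (0 <= (c * (\1_[set` A] x * laplace_parts a b x))%:E)%E.
  by move=> c0; rewrite lee_fin !mulr_ge0// laplace_parts_ge0.
pose cl (i : 'I_k) := nu^-1 * (lam i.+1 / i.+1%:R).
pose cm (i : 'I_k) := nu^-1 * (mu i.+1 / i.+1%:R).
have cl0 i : 0 <= cl i by rewrite /cl mulr_ge0 ?invr_ge0 ?(ltW nu0)// divr_ge0.
have cm0 i : 0 <= cm i by rewrite /cm mulr_ge0 ?invr_ge0 ?(ltW nu0)// divr_ge0.
transitivity (\int[lebesgue_measure]_x
   (\sum_(i < k) (cl i * (\1_[set` `[0%R, i.+1%:R]%R] x * laplace_parts a b x))%:E +
    \sum_(i < k) (cm i * (\1_[set` `[(- i.+1%:R)%R, 0%R]%R] x * laplace_parts a b x))%:E))%E.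
  apply: eq_integral => x _; rewrite !sumEFin -EFinD; congr EFin.
  rewrite /gsp_density /= -/nu !toord mulrDl; congr (_ + _).
    rewrite mulr_sumr mulr_suml; apply: eq_bigr => i _.
    rewrite /cl -!mulrA; do 3 congr (_ * _).
    by rewrite indicE mem_setE in_itv/=; case: ifP.
  rewrite mulr_sumr mulr_suml; apply: eq_bigr => i _.
  rewrite /cm -!mulrA; do 3 congr (_ * _).
  by rewrite indicE mem_setE in_itv/=; case: ifP.
rewrite ge0_integralD//; last 4 first.
- by move=> x _; apply: sume_ge0 => i _; exact: p_ge0.
- by apply: emeasurable_sum => i; exact: m_piece.
- by move=> x _; apply: sume_ge0 => i _; exact: p_ge0.
- by apply: emeasurable_sum => i; exact: m_piece.
do 2 (rewrite ge0_integral_sum;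
  [|by []|by move=> i; exact: m_piece|by move=> i x _; exact: p_ge0]).
rewrite mulrDr EFinD !toord !mulr_sumr -!sumEFin; congr (_ + _)%E; apply: eq_bigr => i _.
  rewrite piece// integral_laplace_parts_pos// -EFinM /cl; congr EFin.
  by rewrite -!mulrA; do 2 congr (_ * _); rewrite mulrA mulVf ?mul1r.
rewrite piece// integral_laplace_parts_neg// -EFinM /cm; congr EFin.
by rewrite -!mulrA; do 2 congr (_ * _); rewrite mulrA mulVf ?mul1r.
Qed.

(** * Compound Poisson sums *)

Lemma measurable_random_index {R : realType} {d : measure_display}
    {Omega : measurableType d} (N : Omega -> nat) (F : nat -> Omega -> R) :
  (forall n, measurable (N @^-1` [set n])) ->
  (forall n, measurable_fun setT (F n)) ->
  measurable_fun setT (fun w => F (N w) w).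
Proof.
move=> mN mF _ B mB; rewrite setTI.
have -> : (fun w => F (N w) w) @^-1` B =
    \bigcup_n (N @^-1` [set n] `&` F n @^-1` B).
  apply/seteqP; split => [w Bw|w [n _ [/= <-]]]//.
  by exists (N w).
apply: bigcupT_measurable => n; apply: measurableI => //.
exact: measurable_preimage.
Qed.

Lemma eseries_exp_coeff {R : realType} (z : R) :
  (\sum_(n <oo) (exp_coeff z n)%:E = (expR z)%:E)%E.
Proof.
rewrite /expR -EFin_lim; last exact: is_cvg_series_exp_coeff.
by apply/congr_lim/funext => n /=; rewrite /series/= -sumEFin.
Qed.

Section compound_poisson.
Context {R : realType} {d : measure_display} {Omega : measurableType d}.
Context (P : probability Omega R) (nu : R) (N : R -> Omega -> nat).
Context (X : nat -> Omega -> R).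
Hypothesis nu0 : 0 <= nu.
Hypothesis poisN : poisson_process P nu N.
Hypothesis mX : forall i, measurable_fun setT (X i).
Hypothesis indX : indep_family P (fun i : nat => sigma_of (X i)).
Hypothesis indXN : indep2 P (sigma_fam setT X)
            (sigma_fam [set t : R | 0 <= t] (fun t w => (N t w)%:R : R)).
Variable t : R.
Hypothesis t0 : 0 <= t.

Lemma poisson_fiberE n :
  N t @^-1` [set n] = (fun w => (N t w)%:R : R) @^-1` [set n%:R].
Proof.
apply/seteqP; split => w /= => [->//|/eqP]; rewrite eqr_nat => /eqP //.
Qed.

Lemma measurable_poisson_fiber n : measurable (N t @^-1` [set n]).
Proof.
have [mN _ _ _ _] := poisN; rewrite poisson_fiberE.
by apply: measurable_preimage => //; exact: mN.
Qed.

Lemma sigma_fam_poisson_fiber n :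
  sigma_fam [set t : R | 0 <= t] (fun t w => (N t w)%:R : R) (N t @^-1` [set n]).
Proof.
apply: sub_sigma_algebra; exists t => //; exists [set n%:R] => //.
by rewrite setTI poisson_fiberE.
Qed.

Lemma poisson_fiber_prob n : P (N t @^-1` [set n]) =
  (expR (- (nu * t)) * (nu * t) ^+ n / (n`!)%:R)%:E.
Proof.
have [_ N0 _ _ pN] := poisN; have := pN 0 t n; rewrite lexx t0 subr0 => /(_ isT) <-.
by congr (P _); apply/seteqP; split => w /=; rewrite N0 subn0.
Qed.

Variable g : R -> R.
Hypothesis g0 : forall x, 0 <= g x.
Hypothesis mg : measurable_fun setT g.

Lemma sigma_fam_prod n B : measurable B ->
  sigma_fam setT X ((fun w => \prod_(0 <= i < n) g (X i w)) @^-1` B).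
Proof.
move=> mB.
pose G := \bigcup_(i in [set: nat]) sigma_of (X i).
have mG i : measurable_fun [set: g_sigma_algebraType G] (X i).
  move=> _ C mC; apply: sub_sigma_algebra; exists i => //.
  by exists C.
have : measurable_fun [set: g_sigma_algebraType G]
    (fun w => \prod_(0 <= i < n) g (X i w)).
  by apply: measurable_prod => i _; exact: measurableT_comp.
by move=> /(_ measurableT B mB); rewrite setTI.
Qed.

Lemma measurable_prod_jumps n :
  measurable_fun setT (fun w => \prod_(0 <= i < n) g (X i w)).
Proof. by apply: measurable_prod => i _; exact: measurableT_comp. Qed.

Lemma integral_prod_fiber (q : R) n :
  (forall i, \int[P]_w (g (X i w))%:E = q%:E)%E ->
  (\int[P]_(w in N t @^-1` [set n]) (\prod_(0 <= i < N t w) g (X i w))%:E =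
   P (N t @^-1` [set n]) * (q ^+ n)%:E)%E.
Proof.
move=> gq.
pose D w := \prod_(0 <= i < n) g (X i w).
have D0 w : 0 <= D w by apply: prodr_ge0 => i _; exact: g0.
have mD : measurable_fun setT D by exact: measurable_prod_jumps.
pose c := fine (P (N t @^-1` [set n])).
have mf := measurable_poisson_fiber n.
have cE : P (N t @^-1` [set n]) = c%:E by rewrite fineK// fin_num_measure.
have c0 : 0 <= c by rewrite fine_ge0.
(* The test function in [eq_weighted_integral] must be nonnegative on all of [R], so the norm, which
   does not change [D], stands in for the identity. *)
transitivity (\int[P]_w (\1_(N t @^-1` [set n]) w * `|D w|)%:E)%E.
  rewrite integral_EFin_indic; apply: eq_integral => w _; congr EFin.
  rewrite mulrC indicE ger0_norm//.
  have [wn|] := boolP (w \in _); last by rewrite !mul0r.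
  by move: wn; rewrite inE => /= ->.
rewrite (@eq_weighted_integral R _ _ _ _ P P _ (fun=> c) D D Num.norm)//.
- under eq_integral do rewrite EFinM ger0_norm//.
  rewrite ge0_integralZl//; last 2 first.
  + exact/measurable_EFinP.
  + by move=> w _; rewrite lee_fin.
  rewrite cE; congr (_ * _)%E.
  rewrite (@indep_integral_prod _ _ _ P _ X (fun=> g) (fun=> q))//.
    by rewrite big_const_nat subn0 iter_mulr_1.
  exact: iota_uniq.
- move=> B mB.
  have mDB : measurable (D @^-1` B) by exact: measurable_preimage.
  rewrite integral_cst// integral_indic// muleC -cE -indXN//.
  + by rewrite setIC.
  + exact: sigma_fam_prod.
  + exact: sigma_fam_poisson_fiber.
Qed.

(** Splitting over the values of [N t] leaves the generating function of a Poisson variable at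
    [q]. *)
Lemma laplace_compound_poisson (q : R) :
  (forall i, \int[P]_w (g (X i w))%:E = q%:E)%E ->
  (\int[P]_w (\prod_(0 <= i < N t w) g (X i w))%:E =
   (expR (nu * t * (q - 1)))%:E)%E.
Proof.
move=> gq.
have q0 : 0 <= q.
  by rewrite -lee_fin -(gq 0%N); apply: integral_ge0 => w _; rewrite lee_fin.
have -> : [set: Omega] = \bigcup_n (N t @^-1` [set n]).
  by apply/seteqP; split => // w _; exists (N t w).
rewrite ge0_integral_bigcup//; last 4 first.
- exact: measurable_poisson_fiber.
- apply/measurable_EFinP; apply: measurable_funTS.
  apply: (measurable_random_index (N t) (fun n w => \prod_(0 <= i < n) g (X i w))).
    exact: measurable_poisson_fiber.
  exact: measurable_prod_jumps.
- by move=> w _; rewrite lee_fin; apply: prodr_ge0.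
- exact: trivIset_preimage1.
transitivity (\sum_(n <oo) ((expR (- (nu * t)))%:E * (exp_coeff (nu * t * q) n)%:E))%E.
  apply: eq_eseriesr => n _; rewrite (integral_prod_fiber q)// poisson_fiber_prob.
  rewrite -!EFinM; congr EFin.
  by rewrite /exp_coeff/=; move: (nu * t) => z; rewrite exprMn -!mulrA [_^-1 * _]mulrC.
rewrite nneseriesZl; last first.
  by move=> n _; rewrite lee_fin exp_coeff_ge0// !mulr_ge0.
by rewrite eseries_exp_coeff -EFinM -expRD; congr (expR _)%:E; rewrite mulrBr mulr1 addrC.
Qed.

End compound_poisson.

(** * Law of a difference *)

(** Rectangles form a pi-system generating the product sigma-algebra, so the pairs agree in law, and
    subtraction is measurable. *)
Lemma eq_in_law_sub {R : realType} {d1 d2 : measure_display}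
    {T1 : measurableType d1} {T2 : measurableType d2}
    (P1 : probability T1 R) (P2 : probability T2 R)
    (X1 Y1 : T1 -> R) (X2 Y2 : T2 -> R) :
  measurable_fun setT X1 -> measurable_fun setT Y1 ->
  measurable_fun setT X2 -> measurable_fun setT Y2 ->
  (forall B C, measurable B -> measurable C ->
    P1 (X1 @^-1` B `&` Y1 @^-1` C) = P2 (X2 @^-1` B `&` Y2 @^-1` C)) ->
  eq_in_law P1 P2 (fun w => X1 w - Y1 w) (fun w => X2 w - Y2 w).
Proof.
move=> mX1 mY1 mX2 mY2 eqR.
pose Z d (T : measurableType d) (X Y : T -> R) w : R * R := (X w, Y w).
have mZ d (T : measurableType d) (X Y : T -> R) : measurable_fun setT X ->
    measurable_fun setT Y -> measurable_fun setT (Z d T X Y).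
  by move=> mX mY; exact/measurable_fun_pairP.
have mpre d (T : measurableType d) (X Y : T -> R) (S : set (R * R)) :
    measurable_fun setT X -> measurable_fun setT Y -> measurable S ->
    measurable (Z d T X Y @^-1` S).
  by move=> mX mY mS; apply: measurable_preimage => //; exact: mZ.
pose G : set (set (R * R)) :=
  [set B `*` C | B in measurable & C in measurable].
pose Q := [set S : set (R * R) |
  P1 (Z _ _ X1 Y1 @^-1` S) = P2 (Z _ _ X2 Y2 @^-1` S)].
have GE : @measurable _ (R * R)%type = <<s G >>.
  exact: measurable_prod_measurableType.
have allQ S : measurable S -> Q S.
  move=> mS; apply: (@dynkin_induction _ _ G Q) => //.
  - move=> _ _ [A1 mA1 [A2 mA2 <-]] [B1 mB1 [B2 mB2 <-]].
    exists (A1 `&` B1); first exact: measurableI.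
    exists (A2 `&` B2); first exact: measurableI.
    by rewrite setXI.
  - by rewrite /Q /= !preimage_setT !probability_setT.
  - by move=> _ [B mB [C mC <-]]; exact: eqR.
  - move=> S' mS'; rewrite /Q /= => eqS.
    have H d (T : measurableType d) (P : probability T R) (X Y : T -> R) :
        measurable_fun setT X -> measurable_fun setT Y ->
        P (Z _ _ X Y @^-1` (~` S')) = (1 - P (Z _ _ X Y @^-1` S'))%E.
      by move=> mX mY; exact: probability_setC (mpre _ _ _ _ _ mX mY mS').
    by rewrite !H// eqS.
  - move=> F mF tF FQ; rewrite /Q /= !preimage_bigcup.
    have H d (T : measurableType d) (P : probability T R) (X Y : T -> R) :
        measurable_fun setT X -> measurable_fun setT Y ->
        P (\bigcup_n (Z _ _ X Y @^-1` F n)) =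
        (\sum_(n <oo) P (Z _ _ X Y @^-1` F n))%E.
      move=> mX mY; rewrite measure_semi_bigcup//.
      + by move=> n; exact: mpre.
      + by move=> i j _ _ [x [xi xj]]; apply: tF => //; exists (Z _ _ X Y x).
      + by apply: bigcupT_measurable => n; exact: mpre.
    by rewrite !H//; apply: eq_eseriesr => n _; exact: FQ.
  - by rewrite -GE.
move=> B mB; apply: (allQ [set z | B (z.1 - z.2)]).
have mD : measurable_fun setT (fun z : R * R => z.1 - z.2).
  by apply: measurable_funB.
exact: measurable_preimage.
Qed.

Lemma time_avgE {R : realType} {d : measure_display} {Omega : measurableType d}
    (P : probability Omega R) (M1 M2 : R -> Omega -> nat) (t : R) (w : Omega) :
  0 < t -> levy_nat P M1 -> levy_nat P M2 ->
  time_avg M1 M2 t w = time_mean M1 t w - time_mean M2 t w.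
Proof.
move=> t0 [_ _ c1 _ _] [_ _ c2 _ _].
have [_ i1 _] := cvg_riemann_cadlag (fun s => (M1 s w)%:R) t t0 (fun=> ler0n _ _) (c1 w).
have [_ i2 _] := cvg_riemann_cadlag (fun s => (M2 s w)%:R) t t0 (fun=> ler0n _ _) (c2 w).
rewrite /time_avg /time_mean -mulrBr; congr (_ * _).
under eq_integral do rewrite EFinB.
rewrite integralB//= fineB//; exact: integrable_fin_num.
Qed.

Theorem theorem7p1 (R : realType) (k : nat) (lam mu : nat -> R)
  (d : measure_display) (Omega : measurableType d) (P : probability Omega R)
  (M1 M2 : R -> Omega -> nat)
  (d' : measure_display) (Omega' : measurableType d') (P' : probability Omega' R)
  (N : R -> Omega' -> nat) (X : nat -> Omega' -> R) :
  (forall j, (1 <= j <= k)%N -> 0 <= lam j) ->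
  (forall j, (1 <= j <= k)%N -> 0 <= mu j) ->
  0 < \sum_(1 <= j < k.+1) lam j + \sum_(1 <= j < k.+1) mu j ->
  GCP P k lam M1 -> GCP P k mu M2 ->
  indep2 P (sigma_fam [set t : R | 0 <= t] (fun t w => (M1 t w)%:R : R))
           (sigma_fam [set t : R | 0 <= t] (fun t w => (M2 t w)%:R : R)) ->
  poisson_process P'
    (\sum_(1 <= j < k.+1) lam j + \sum_(1 <= j < k.+1) mu j) N ->
  (forall i, has_density P' (X i) (gsp_density k lam mu)) ->
  indep_family P' (fun i : nat => sigma_of (X i)) ->
  indep2 P' (sigma_fam setT X)
            (sigma_fam [set t : R | 0 <= t] (fun t w => (N t w)%:R : R)) ->
  forall t : R, 0 < t ->
    eq_in_law P P' (time_avg M1 M2 t)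
      (fun w => \sum_(0 <= i < N t w) X i w).
Proof.
set nu := _ + _.
move=> lam0 mu0 nu0 [levy1 pgf1] [levy2 pgf2] ind12 poisN densX indX indXN t t0.
have mX i : measurable_fun setT (X i) by have [] := densX i.
have [mA1 mA2] : measurable_fun setT (time_mean M1 t) /\
    measurable_fun setT (time_mean M2 t).
  by split; apply: (measurable_time_mean P).
pose S (h : R -> R) w := \sum_(0 <= i < N t w) h (X i w).
have mS h : measurable_fun setT h -> measurable_fun setT (S h).
  move=> mh; apply: (measurable_random_index (N t)
      (fun n w => \sum_(0 <= i < n) h (X i w))).
    by move=> n; apply: (measurable_poisson_fiber P' nu N poisN); exact: ltW.
  by move=> n; apply: measurable_sum => i; exact: measurableT_comp.
pose Bp := S (fun x => Num.max x 0).
pose Bn := S (fun x => Num.max (- x) 0).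
have mBp : measurable_fun setT Bp by apply: mS; exact: measurable_pos_part.
have mBn : measurable_fun setT Bn by apply: mS; exact: measurable_neg_part.
have Bp0 w : 0 <= Bp w by apply: sumr_ge0 => i _; rewrite le_max lexx orbT.
have Bn0 w : 0 <= Bn w by apply: sumr_ge0 => i _; rewrite le_max lexx orbT.
have BE w : \sum_(0 <= i < N t w) X i w = Bp w - Bn w.
  rewrite /Bp /Bn /S -sumrB; apply: eq_bigr => i _.
  have [x0|x0] := leP 0 (X i w).
    by rewrite max_r ?oppr_le0// subr0.
  by rewrite max_l ?oppr_ge0 ?ltW// opprK add0r.
pose phi lam' (a : R) := expR (t * \sum_(1 <= j < k.+1) lam' j * (unif_laplace a j - 1)).
have lap1 (a : R) : 0 <= a ->
    (\int[P]_w (expR (- (a * time_mean M1 t w)))%:E = (phi lam a)%:E)%E.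
  by move=> a0; exact: laplace_time_mean.
have lap2 (a : R) : 0 <= a ->
    (\int[P]_w (expR (- (a * time_mean M2 t w)))%:E = (phi mu a)%:E)%E.
  by move=> a0; exact: laplace_time_mean.
have lapB (a b : R) :
    (\int[P']_w (expR (- (b * Bn w)) * expR (- (a * Bp w)))%:E =
     (phi mu b * phi lam a)%:E)%E.
  pose q := nu^-1 * (\sum_(1 <= j < k.+1) lam j * unif_laplace a j +
             \sum_(1 <= j < k.+1) mu j * unif_laplace b j).
  have gq i : (\int[P']_w (laplace_parts a b (X i w))%:E = q%:E)%E.
    rewrite /q -integral_gsp_density//.
    have [_ dX] := densX i.
    (* Transfer to the density: weight 1 under [P'] against the density under Lebesgue measure. *)
    have := @eq_weighted_integral R _ _ _ _ P' lebesgue_measure (fun=> 1)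
      (gsp_density k lam mu) (X i) id (laplace_parts a b).
    under eq_integral do rewrite mul1r.
    apply => //.
    - by move=> x; exact: gsp_density_ge0.
    - exact: measurable_gsp_density.
    - move=> B mB; rewrite integral_cst; last exact: measurable_preimage.
      by rewrite mul1e; exact: dX.
    - exact: laplace_parts_ge0.
    - exact: measurable_laplace_parts.
  transitivity (\int[P']_w (\prod_(0 <= i < N t w) laplace_parts a b (X i w))%:E)%E.
    apply: eq_integral => w _; rewrite -expRD -expR_sum; congr (expR _)%:E.
    rewrite big_split/= !sumrN -!mulr_sumr addrC; congr (_ + _).
  rewrite (@laplace_compound_poisson _ _ _ P' nu N X (ltW nu0) poisN mX indX indXN
    t (ltW t0) (laplace_parts a b) (laplace_parts_ge0 a b)
    (measurable_laplace_parts a b) q gq).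
  (* In [nu * (q - 1)] the factor [nu] cancels its inverse in [q], and the subtracted [nu] is the
     sum of all rates, one for each [- 1] on the other side. *)
  rewrite -expRD; congr (expR _)%:E.
  under [X in _ = t * X + _]eq_bigr do rewrite mulrBr mulr1.
  under [X in _ = _ + t * X]eq_bigr do rewrite mulrBr mulr1.
  rewrite !big_split/= !sumrN /q [nu * t]mulrC -mulrA mulrBr mulrA mulfV ?gt_eqF//.
  by rewrite mul1r mulr1 -mulrDr; congr (_ * _); rewrite /nu; ring.
(* [phi] will be a constant weight in [laplace_unique], hence must lie in [[0, 1]]; it does, as the
   transform of a nonnegative variable. *)
have phi_le1 m lam' (A : Omega -> R) : (forall w, 0 <= A w) ->
    measurable_fun setT A -> (\int[P]_w (expR (- (m%:R * A w)))%:E = (phi lam' m%:R)%:E)%E ->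
    0 <= phi lam' m%:R <= 1.
  move=> A0 mA phiE; rewrite expR_ge0/= -lee_fin -phiE.
  apply: (@le_trans _ _ (\int[P]_w (cst 1%E) w)%E).
    apply: ge0_le_integral => //.
    - apply/measurable_EFinP; apply: measurableT_comp => //.
      by apply: measurable_funN; exact: measurable_funM.
    - by move=> w _; rewrite lee_fin -expR0 ler_expR oppr_le0 mulr_ge0.
  by rewrite integral_cst// mul1e; exact: probability_le1.
(* With the argument [m] of [Bn] frozen in the weight, uniqueness in the other argument makes the
   weighted law of [Bp] a multiple of the law of the first average. *)
have stepA (m : nat) B : measurable B ->
    (\int[P']_(w in Bp @^-1` B) (expR (- (m%:R * Bn w)))%:E =
     (phi mu m%:R)%:E * P (time_mean M1 t @^-1` B))%E.
  move=> mB.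
  rewrite (@laplace_unique _ _ _ _ _ P' P _ Bp (fun=> phi mu m%:R) (time_mean M1 t))//.
  - by rewrite integral_cst//; exact: measurable_preimage.
  - by move=> w; rewrite expR_ge0/= -expR0 ler_expR oppr_le0 mulr_ge0.
  - by move=> _; apply: (phi_le1 m mu (time_mean M2 t)) => //; [move=> w; exact: time_mean_ge0|exact: lap2].
  - by apply: measurableT_comp => //; apply: measurable_funN; exact: measurable_funM.
  - by move=> w; exact: time_mean_ge0.
  - move=> n; rewrite lapB; under eq_integral do rewrite EFinM.
    rewrite ge0_integralZl//; last 2 first.
    + apply/measurable_EFinP; apply: measurableT_comp => //.
      by apply: measurable_funN; exact: measurable_funM.
    + by rewrite lee_fin expR_ge0.
    by rewrite lap1// EFinM.
(* Now the event for [Bp] is the weight, and [stepA], read as a function of [m], is the weighted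
   transform of [Bn]. *)
have stepB B C : measurable B -> measurable C ->
    P (time_mean M1 t @^-1` B `&` time_mean M2 t @^-1` C) =
    P' (Bp @^-1` B `&` Bn @^-1` C).
  move=> mB mC.
  have mBB : measurable (time_mean M1 t @^-1` B) by exact: measurable_preimage.
  have mBC : measurable (time_mean M2 t @^-1` C) by exact: measurable_preimage.
  have mBpB : measurable (Bp @^-1` B) by exact: measurable_preimage.
  have mBnC : measurable (Bn @^-1` C) by exact: measurable_preimage.
  pose c := fine (P (time_mean M1 t @^-1` B)).
  have cE : P (time_mean M1 t @^-1` B) = c%:E by rewrite fineK// fin_num_measure.
  have c01 : 0 <= c <= 1.
    by rewrite -!lee_fin -cE measure_ge0 probability_le1.
  (* Independence of [M1] and [M2] enters here. *)
  transitivity (c%:E * P (time_mean M2 t @^-1` C))%E.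
    rewrite -cE; apply: ind12.
    - exact: (time_mean_sigma_fam P).
    - exact: (time_mean_sigma_fam P).
  transitivity (\int[P]_(w in time_mean M2 t @^-1` C) c%:E)%E.
    by rewrite integral_cst.
  transitivity (\int[P']_(w in Bn @^-1` C) (\1_(Bp @^-1` B) w)%:E)%E; last first.
    by rewrite integral_indic.
  apply/esym; apply: (@laplace_unique _ _ _ _ _ P' P _ Bn (fun=> c) (time_mean M2 t)) => //.
  - by move=> w; rewrite indicE; case: (_ \in _); rewrite ?lexx ler01.
  - by move=> w; exact: time_mean_ge0.
  - move=> m; under [RHS]eq_integral do rewrite EFinM.
    rewrite ge0_integralZl//; last 2 first.
    + apply/measurable_EFinP; apply: measurableT_comp => //.
      by apply: measurable_funN; exact: measurable_funM.
    + by rewrite lee_fin; have /andP[] := c01.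
    rewrite lap2// muleC -cE -stepA// [RHS]integral_EFin_indic.
    by apply: eq_integral => w _; rewrite mulrC.
have := eq_in_law_sub P P' _ _ _ _ mA1 mA2 mBp mBn stepB.
rewrite /eq_in_law => H B mB.
have -> : time_avg M1 M2 t = (fun w => time_mean M1 t w - time_mean M2 t w).
  by apply/funext => w; apply: (time_avgE P).
have -> : (fun w => \sum_(0 <= i < N t w) X i w) = (fun w => Bp w - Bn w).
  by apply/funext.
exact: H.
Qed.
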